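(* Let $m\ge 2$ be an integer and let $P_n=P_{-4,n}(c)$, $n\ge 0$, be the polynomials in $c$ defined by $P_0=1$, $P_1=P_2=P_3=0$ and $$(km+m+4)\,P_{k+4}(c)=2c\,((k-1)m+2)\,P_{k+2}(c)-(k-3)m\,P_k(c),\qquad k\ge 0 .$$ Then for every $n\ge 0$ the polynomial $P_n$ satisfies the fourth order linear differential equation (derivatives with respect to $c$) $$\begin{aligned} 0={}&16(c^2-1)^2m^2\,P_n^{(iv)}+160\,c\,(c^2-1)m^2\,P_n'''\\ &+\Bigl(8m\bigl(m((n-6)n-10)+4(n-6)\bigr)-8c^2\bigl(m^2(n-10)(n+4)+4m(n-4)+8\bigr)\Bigr)P_n''\\ &-24c\bigl(m^2(n-6)n+4m(n-4)+8\bigr)P_n'\\ &+(n-4)\,n\,(m(n-6)+4)\,(m(n-2)+4)\,P_n . \end{aligned}$$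
   Context: The polynomials $P_{-4,n}(c)$ are the coefficients of $z^n$ in a generating function $P_{-4}(c,z)=\sum_{n\ge0}P_{-4,n}(c)z^n$ attached to the superelliptic curve $u^m=1-2ct^2+t^4$. They are determined by the initial values and recursion given in the claim. In particular $P_{-4,n}=0$ for all odd $n$, $P_{-4,4}=\frac{3m}{m+4}$ and $P_{-4,6}=\frac{6cm(m+2)}{(m+4)(3m+4)}$. *)

(* Defs.v *)
From mathcomp Require Export all_boot all_order all_algebra.

Set Implicit Arguments.
Unset Strict Implicit.
Unset Printing Implicit Defensive.

Import GRing.Theory.
Local Open Scope ring_scope.

(* The family (P_(-4,n))_n over a field F, with the variable c rendered as 'X.
   When F has characteristic 0 the factor k m + m + 4 never vanishes, so there
   is exactly one such family. *)
Definition is_Pm4 (F : fieldType) (m : nat) (P : nat -> {poly F}) : Prop :=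
  [/\ P 0%N = 1, P 1%N = 0, P 2%N = 0, P 3%N = 0 &
      forall k : nat,
        (k%:R * m%:R + m%:R + 4) * P k.+4
        = 2 * 'X * ((k%:R - 1) * m%:R + 2) * P k.+2
          - (k%:R - 3) * m%:R * P k].

(* Main.v *)
(* Put w = 2m(1 - c^2).  The recurrence is that of Gegenbauer functions, and the
   structure relation of the latter suggests the operator
     (T y)_n = w y_n' - (n-3)mc y_n + ((n-1)m+4) y_(n+2),
   which maps solutions of the recurrence to solutions.  Since a solution is
   determined by its first four terms, T^2 P = (2m+4)c T P + 3m(m+4)(1-c^2) P.
   Hence P_n, P_(n+2), (T P)_n, (T P)_(n+2) span a module stable under the
   derivation w d/dc, and the differential equation is a linear relation among
   the iterates of w d/dc on P_n, read in this module. *)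
Require Import Defs.
From mathcomp Require Import all_boot all_order all_algebra.
From mathcomp Require Import ring.
Import GRing.Theory.
Local Open Scope ring_scope.

(** This turns an equation that follows from a known one into an identity between differences, which
    [ring] can settle. *)
Lemma eq_from_subr {V : zmodType} {a b a' b' : V} :
  a = b -> a' - b' = a - b -> a' = b'.
Proof. by move=> -> h; apply/eqP; rewrite -subr_eq0 h subrr. Qed.

Lemma deriv_natr (R : nzRingType) (k : nat) : (k%:R : {poly R})^`() = 0.
Proof. by rewrite -polyC_natr derivC. Qed.

Lemma natr_poly_eq0 {F : fieldType} (k : nat) : [pchar F] =i pred0 ->
  ((k%:R : {poly F}) == 0) = (k == 0%N).
Proof.
by move=> /pcharf0P charF0; rewrite -polyC_natr polyC_eq0 charF0.
Qed.

(** * Solutions of the recurrence and the operator [Top] *)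

Section Recurrence.

Set Implicit Arguments.

Variables (F : fieldType) (m : nat).
Implicit Types (y z : nat -> {poly F}) (f g : {poly F}).

Local Notation M := (m%:R : {poly F}).
Local Notation c := ('X : {poly F}).

Definition Pm4_rec y : Prop := forall k : nat,
  (k%:R * M + M + 4) * y k.+4
  = 2 * c * ((k%:R - 1) * M + 2) * y k.+2 - (k%:R - 3) * M * y k.

Definition weight : {poly F} := 2 * M * (1 - c ^+ 2).

Local Notation w := weight.

Definition Top y (n : nat) : {poly F} :=
  w * (y n)^`() - (n%:R - 3) * M * c * y n + ((n%:R - 1) * M + 4) * y n.+2.

(** The recurrence is linear over polynomials in [c], so [f] and [g] need not be constants, only
    independent of [n]. *)
Lemma Pm4_rec_comb y z u f g : Pm4_rec y -> Pm4_rec z -> Pm4_rec u ->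
  Pm4_rec (fun n => u n - f * z n - g * y n).
Proof.
move=> hy hz hu k.
have -> : forall a, a * (u k.+4 - f * z k.+4 - g * y k.+4) =
  a * u k.+4 - f * (a * z k.+4) - g * (a * y k.+4) by move=> a; ring.
by rewrite hy hz hu; ring.
Qed.

Lemma deriv_Pm4_rec y k : Pm4_rec y ->
  (k%:R * M + M + 4) * (y k.+4)^`()
  = 2 * ((k%:R - 1) * M + 2) * y k.+2
    + 2 * c * ((k%:R - 1) * M + 2) * (y k.+2)^`()
    - (k%:R - 3) * M * (y k)^`().
Proof.
move=> /(_ k) /(congr1 (@deriv F)).
rewrite !(derivM, derivD, derivB, deriv_natr, derivX, derivN) derivC => h.
by apply: (eq_from_subr h); ring.
Qed.

Lemma Pm4_rec_Top y : Pm4_rec y -> Pm4_rec (Top y).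
Proof.
move=> hy k; rewrite /Top /weight.
have h1 := hy k; have h2 := hy k.+2; have h3 := deriv_Pm4_rec k hy.
have e2 : k.+2%:R = k%:R + 2 :> {poly F} by rewrite -addn2 natrD.
have e4 : k.+4%:R = k%:R + 4 :> {poly F} by rewrite -addn4 natrD.
rewrite e2 in h2; rewrite e2 e4.
(* The multipliers are forced by the terms in [y k], [y k.+6] and the derivative of [y k.+4], in
   this order. *)
have h := congr2 +%R (congr1 ( *%R ((3 - k%:R) * M * c)) h1)
  (congr2 +%R (congr1 ( *%R (k%:R * M + M + 4)) h2)
              (congr1 ( *%R (2 * M * (1 - c ^+ 2))) h3)).
by apply: (eq_from_subr h); ring.
Qed.

Hypothesis charF0 : [pchar F] =i pred0.

Lemma Pm4_lead_neq0 (k : nat) : k%:R * M + M + 4 != 0.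
Proof.
have -> : k%:R * M + M + 4 = (k * m + m + 4)%:R by rewrite !natrD natrM.
by rewrite natr_poly_eq0 // addn_eq0 andbF.
Qed.

Lemma Pm4_rec_eq0 y : Pm4_rec y -> y 0 = 0 -> y 1 = 0 -> y 2 = 0 -> y 3 = 0 ->
  forall n, y n = 0.
Proof.
move=> hy y0 y1 y2 y3 n.
suff [//] : [/\ y n = 0, y n.+1 = 0, y n.+2 = 0 & y n.+3 = 0].
elim: n => [//|n [yn yn1 yn2 yn3]]; split=> //.
apply: (mulfI (Pm4_lead_neq0 n)).
by rewrite hy yn yn2 !mulr0 subr0.
Qed.

Lemma Top_Top P : is_Pm4 m P -> forall n,
  Top (Top P) n
  = (2 * M + 4) * c * Top P n + 3 * M * (M + 4) * (1 - c ^+ 2) * P n.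
Proof.
move=> [P0 P1 P2 P3 hP] n.
have hT := Pm4_rec_Top hP; have hTT := Pm4_rec_Top hT.
have d0 : (0 : {poly F})^`() = 0 by rewrite -polyC0 derivC.
have d1 : (1 : {poly F})^`() = 0 by rewrite derivC.
have A1 := Pm4_lead_neq0 1.
have P4 : (M + 4) * P 4 = 3 * M.
  by have := hP 0; rewrite P0 P2 => h; apply: (eq_from_subr h); ring.
have P5 : P 5 = 0 by apply: (mulfI A1); rewrite hP P1 P3; ring.
have T0 : Top P 0 = 3 * M * c by rewrite /Top P0 P2 d1; ring.
have T1 : Top P 1 = 0 by rewrite /Top P1 P3 d0; ring.
have T2 : Top P 2 = 3 * M.
  by rewrite /Top P2 d0; apply: (eq_from_subr P4); ring.
have T3 : Top P 3 = 0 by rewrite /Top P3 P5 d0; ring.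
have T5 : Top P 5 = 0 by apply: (mulfI A1); rewrite hT T1 T3; ring.
have T4 := hT 0; rewrite T0 T2 in T4.
have dT0 : (3 * M * c)^`() = 3 * M.
  by rewrite !derivM derivX !deriv_natr; ring.
have dT2 : (3 * M)^`() = 0 by rewrite derivM !deriv_natr; ring.
(* The difference of the two sides solves the recurrence, so only the indices 0 to 3 remain to be
   checked. *)
apply/eqP; rewrite -subr_eq0 opprD addrA; apply/eqP; move: n.
apply: (Pm4_rec_eq0 (Pm4_rec_comb _ _ hP hT hTT)).
- by rewrite T0 P0 {1}/Top T0 T2 dT0 /weight; ring.
- by rewrite T1 P1 {1}/Top T1 T3 d0; ring.
- by rewrite T2 P2 {1}/Top T2 dT2; apply: (eq_from_subr T4); ring.
- by rewrite T3 P3 {1}/Top T3 T5 d0; ring.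
Qed.

End Recurrence.

(** * The derivation [w] d/dc and the differential equation *)

Section ThetaOperator.

Set Implicit Arguments.

Variables (F : fieldType) (m : nat).

Local Notation M := (m%:R : {poly F}).
Local Notation c := ('X : {poly F}).
Local Notation w := (weight F m).

(* Locked, lest unification read [theta (theta f)] as [theta] of a product. *)
Definition theta := locked (fun f : {poly F} => w * f^`()).

Lemma theta_def f : theta f = w * f^`().
Proof. by rewrite /theta -lock. Qed.

Lemma thetaD f g : theta (f + g) = theta f + theta g.
Proof. by rewrite !theta_def derivD mulrDr. Qed.

Lemma thetaB f g : theta (f - g) = theta f - theta g.
Proof. by rewrite !theta_def derivB mulrBr. Qed.

Lemma thetaM f g : theta (f * g) = theta f * g + f * theta g.
Proof. by rewrite !theta_def derivM; ring. Qed.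

Lemma thetaX : theta c = w.
Proof. by rewrite !theta_def derivX mulr1. Qed.

Lemma theta_natr (k : nat) : theta k%:R = 0.
Proof. by rewrite !theta_def deriv_natr mulr0. Qed.

Lemma theta_w : theta w = - (4 * M * c) * w.
Proof.
rewrite theta_def {2}/weight expr2 !(derivM, derivB, derivX, deriv_natr) derivC.
by ring.
Qed.

Lemma theta0 : theta 0 = 0.
Proof. exact: (theta_natr 0). Qed.

Lemma theta1 : theta 1 = 0.
Proof. exact: (theta_natr 1). Qed.

Lemma thetaN f : theta (- f) = - theta f.
Proof. by rewrite !theta_def derivN mulrN. Qed.

Definition thetaE := (theta_natr, theta1, thetaX, theta_w, thetaN, thetaD,
  thetaB, thetaM, mulr0, mul0r, add0r, addr0, oppr0).

Definition ode_op (n : nat) (p : {poly F}) : {poly F} :=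
  let N : {poly F} := n%:R in
  16 * (c ^+ 2 - 1) ^+ 2 * M ^+ 2 * p^`(4)
  + 160 * c * (c ^+ 2 - 1) * M ^+ 2 * p^`(3)
  + (8 * M * (M * ((N - 6) * N - 10) + 4 * (N - 6))
     - 8 * c ^+ 2 * (M ^+ 2 * (N - 10) * (N + 4) + 4 * M * (N - 4) + 8))
    * p^`(2)
  - 24 * c * (M ^+ 2 * (N - 6) * N + 4 * M * (N - 4) + 8) * p^`()
  + (N - 4) * N * (M * (N - 6) + 4) * (M * (N - 2) + 4) * p.

(** Here and in the next two lemmas, each expansion in ordinary derivatives comes from applying
    [theta] to the previous one. *)
Lemma theta2E p :
  theta (theta p) = w ^+ 2 * p^`(2) - 4 * M * c * w * p^`().
Proof.
by rewrite [theta p]theta_def thetaM theta_w theta_def derivnS derivn1; ring.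
Qed.

Lemma theta3E p :
  theta (theta (theta p)) = w ^+ 3 * p^`(3) - 12 * M * c * w ^+ 2 * p^`(2)
    + (16 * M ^+ 2 * c ^+ 2 - 4 * M * w) * w * p^`().
Proof.
rewrite [theta (theta p)]theta2E expr2 !thetaE.
by rewrite !theta_def !derivnS derivn0; ring.
Qed.

Lemma theta4E p :
  theta (theta (theta (theta p))) = w ^+ 4 * p^`(4)
    - 24 * M * c * w ^+ 3 * p^`(3)
    + (112 * M ^+ 2 * c ^+ 2 - 16 * M * w) * w ^+ 2 * p^`(2)
    + (64 * M ^+ 2 * c * w - 64 * M ^+ 3 * c ^+ 3) * w * p^`().
Proof.
rewrite [theta (theta (theta p))]theta3E !(expr2, exprS, expr1, expr0) !thetaE.
by rewrite !theta_def !derivnS derivn0; ring.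
Qed.

(** The leading coefficient of [ode_op] is 4 w^2, so the factor w^2 makes the top term that of 4
    theta^4; the other coefficients follow by matching derivatives in descending order. Here [w1],
    [w2] are w', w'', and [e2], [e1], [e0] are the lower coefficients of [ode_op]. *)
Lemma ode_op_theta n p :
  let N : {poly F} := n%:R in
  let w1 := - (4 * M * c) in let w2 := - (4 * M) in
  let e2 := 8 * M * (M * ((N - 6) * N - 10) + 4 * (N - 6))
     - 8 * c ^+ 2 * (M ^+ 2 * (N - 10) * (N + 4) + 4 * M * (N - 4) + 8) in
  let e1 := - (24 * c * (M ^+ 2 * (N - 6) * N + 4 * M * (N - 4) + 8)) in
  let e0 := (N - 4) * N * (M * (N - 6) + 4) * (M * (N - 2) + 4) in
  let a2 := e2 - 4 * (7 * w1 ^+ 2 + 4 * w * w2) - 48 * c * M * w1 in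
  let a1 := w * e1 - 4 * (w1 ^+ 3 + 4 * w * w1 * w2)
    - 16 * c * M * (w1 ^+ 2 + w * w2) - a2 * w1 in
  w ^+ 2 * ode_op n p =
    4 * theta (theta (theta (theta p))) + 16 * c * M * theta (theta (theta p))
    + a2 * theta (theta p) + a1 * theta p + w ^+ 2 * e0 * p.
Proof.
cbv zeta; rewrite theta4E theta3E theta2E /ode_op [theta p]theta_def /weight.
by ring.
Qed.

Lemma weight_neq0 : [pchar F] =i pred0 -> (0 < m)%N -> w != 0.
Proof.
move=> charF0 m_gt0; rewrite /weight -natrM mulf_neq0 //.
  by rewrite natr_poly_eq0 // muln_eq0 /= -lt0n.
by rewrite -oppr_eq0 opprB -size_poly_eq0 size_XnsubC.
Qed.

(** The letters [p], [q], [r], [s] stand for P_n, P_(n+2), (T P)_n, (T P)_(n+2). The coefficients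
    [a], [b] come from the definition of T, [d] and [e] from eliminating P_(n+4), [t] and [u] from
    the formula for T^2 P. *)
Lemma ode_of_system n p q r s :
  let N : {poly F} := n%:R in
  let a := (N - 3) * M * c in let b := (N - 1) * M + 4 in
  let d := (N - 1) * M * c - 2 * c * ((N - 1) * M + 2) in
  let e := (N - 3) * M in
  let t := (2 * M + 4) * c in let u := 3 * M * (M + 4) * (1 - c ^+ 2) in
  w != 0 ->
  theta p = r + a * p - b * q -> theta q = s + d * q + e * p ->
  theta r = t * r + u * p + a * r - b * s ->
  theta s = t * s + u * q + d * s + e * r ->
  ode_op n p = 0.
Proof.
move=> N a b d e t u w0 hp hq hr hs.
apply: (mulfI (expf_neq0 2 w0)); rewrite mulr0 ode_op_theta.
have ha : theta a = (N - 3) * M * w by rewrite /a !thetaE; ring.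
have hb : theta b = 0 by rewrite /b !thetaE; ring.
have hd : theta d = - ((N - 1) * M + 4) * w by rewrite /d !thetaE; ring.
have he : theta e = 0 by rewrite /e !thetaE; ring.
have ht : theta t = (2 * M + 4) * w by rewrite /t !thetaE; ring.
have hu : theta u = - (6 * M * (M + 4) * c * w)
  by rewrite /u expr2 !thetaE; ring.
pose hconst := (theta_natr, theta0, theta_w, thetaX, ha, hb, hd, he, ht, hu).
(* All iterates become combinations of [p], [q], [r], [s], and the four total coefficients vanish
   identically. *)
rewrite !(hp, hq, hr, hs, hconst, thetaN, thetaD, thetaB, thetaM).
rewrite /a /b /d /e /t /u /N /weight.
by ring.
Qed.

End ThetaOperator.

Theorem theorem2p1 (F : fieldType) (charF0 : [pchar F] =i pred0)
    (m : nat) (hm : (2 <= m)%N) (P : nat -> {poly F}) (hP : is_Pm4 m P)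
    (n : nat) :
  let c : {poly F} := 'X in
  let M : {poly F} := m%:R in
  let N : {poly F} := n%:R in
  0 = 16 * (c ^+ 2 - 1) ^+ 2 * M ^+ 2 * (P n)^`(4)
      + 160 * c * (c ^+ 2 - 1) * M ^+ 2 * (P n)^`(3)
      + (8 * M * (M * ((N - 6) * N - 10) + 4 * (N - 6))
         - 8 * c ^+ 2 * (M ^+ 2 * (N - 10) * (N + 4) + 4 * M * (N - 4) + 8))
        * (P n)^`(2)
      - 24 * c * (M ^+ 2 * (N - 6) * N + 4 * M * (N - 4) + 8) * (P n)^`()
      + (N - 4) * N * (M * (N - 6) + 4) * (M * (N - 2) + 4) * P n.
Proof.
symmetry; have hTT := Top_Top charF0 hP.
have hrec : Pm4_rec m P by case: hP.
have hT := Pm4_rec_Top hrec.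
have e2 : n.+2%:R = n%:R + 2 :> {poly F} by rewrite -addn2 natrD.
have w0 : weight F m != 0 by apply: weight_neq0 => //; apply: ltnW.
apply: (@ode_of_system F m n _ (P n.+2) (Top m P n) (Top m P n.+2) w0).
- by rewrite /Top theta_def; ring.
(* The factor of P_(n+4) in (T P)_(n+2) is the leading factor of the recurrence at [n], which thus
   eliminates it. *)
- by apply: (eq_from_subr (esym (hrec n))); rewrite /Top theta_def e2; ring.
- apply: (eq_from_subr (hTT n)).
  by rewrite [Top m (Top m P) n]/Top theta_def; ring.
(* Likewise the recurrence for T P eliminates (T P)_(n+4). *)
- have h := congr2 +%R (hTT n.+2) (esym (hT n)).
  apply: (eq_from_subr h).
  by rewrite [Top m (Top m P) n.+2]/Top theta_def e2; ring.
Qed.
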